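(* For every $n\ge 2$, the $n$-cube $Q^n$ is $Q$-unique: if $H$ is a finite simple graph with $Q(H;x,y)=Q(Q^n;x,y)$, then $H\cong Q^n$.
   Context: For a finite simple graph $G=(V,E)$, the subgraph component polynomial is $Q(G;x,y)=\sum_{X\subseteq V} x^{|X|}y^{k(G[X])}$, where $G[X]$ is the induced subgraph on $X$ and $k(\cdot)$ denotes the number of connected components. The $n$-cube $Q^n$ is the Cartesian product of $n$ copies of $K_2$, i.e. the graph on $\{0,1\}^n$ in which two vertices are adjacent iff they differ in exactly one coordinate. *)

(* Defs.v *)
From HB Require Import structures.
From mathcomp Require Import all_boot all_order all_algebra.

Set Implicit Arguments.
Unset Strict Implicit.
Unset Printing Implicit Defensive.

Import GRing.Theory.

Record sgraph := SGraph {
  vertex :> finType;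
  adj : rel vertex;
  adj_sym : symmetric adj;
  adj_irr : irreflexive adj
}.

Section Induced.
Variables (G : sgraph) (X : {set G}).

Definition induced_rel : rel {x : G | x \in X} :=
  fun u v => adj (val u) (val v).

Lemma induced_sym : symmetric induced_rel.
Proof. by move=> u v; apply: adj_sym. Qed.

Lemma induced_irr : irreflexive induced_rel.
Proof. by move=> u; apply: adj_irr. Qed.

Definition induced : sgraph := SGraph induced_sym induced_irr.

End Induced.

(* [n_comp e predT] counts the classes of [connect e], the reflexive
   transitive closure of [e]; here [e] is symmetric, so these classes are the
   connected components.  The graph with no vertices has none. *)
Definition ncomponents (G : sgraph) : nat := n_comp (@adj G) predT.

(* Z[x, y] is represented as {poly {poly int}}: the inner indeterminate
   ['X%:P] is x and the outer indeterminate ['X] is y. *)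
Definition varx : {poly {poly int}} := ('X%:P)%R.
Definition vary : {poly {poly int}} := 'X%R.

Definition subgraph_component_poly (G : sgraph) : {poly {poly int}} :=
  (\sum_(X : {set G}) varx ^+ #|X| * vary ^+ ncomponents (induced X))%R.

Definition isomorphic (G H : sgraph) : Prop :=
  exists2 f : G -> H, bijective f & forall u v, adj (f u) (f v) = adj u v.

Definition Q_unique (G : sgraph) : Prop :=
  forall H : sgraph,
    subgraph_component_poly H = subgraph_component_poly G -> isomorphic H G.

Section Cube.
Variable n : nat.

Definition cube_rel : rel {ffun 'I_n -> bool} :=
  fun u v => #|[set i | u i != v i]| == 1.

Lemma cube_sym : symmetric cube_rel.
Proof.
move=> u v; rewrite /cube_rel; congr (_ == 1); apply: eq_card => i.
by rewrite !inE eq_sym.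
Qed.

Lemma cube_irr : irreflexive cube_rel.
Proof.
move=> u; rewrite /cube_rel; apply/negbTE/eqP.
by rewrite (_ : [set _ | _] = set0) ?cards0 //; apply/setP=> i; rewrite !inE eqxx.
Qed.

Definition cube : sgraph := SGraph cube_sym cube_irr.

End Cube.

(* Main.v *)
(* The polynomial Q(G) records how many vertex sets of each size induce each
   number of components.  Deleting fewer than n vertices from the n-cube keeps
   it connected, and deleting fewer than 2n - 2 vertices leaves at most two
   components.  If Q(H) = Q(Q^n), the same holds in H.  Isolating one vertex by
   deleting its neighbourhood gives minimum degree >= n, and isolating two
   non-adjacent vertices shows that they have at most two common neighbours.
   The sizes 2, 3 and 4 give the number of edges (so H is n-regular), the absence
   of triangles, and the number of 4-cycles; since the latter is the same as in
   the cube, every two vertices of H have 0 or 2 common neighbours.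
   In a connected n-regular graph with this last property, a vertex at distance
   i from a base point has at least i neighbours at distance i - 1, so the
   sphere of radius i has at most binomial(n, i) vertices.  As H has 2^n vertices,
   equality holds throughout; then sending v to the set of neighbours of the base
   point that are closer to v is an isomorphism onto the cube (Mulder). *)

Require Import Defs.
From mathcomp Require Import all_boot all_order all_algebra.
From mathcomp Require Import zify.

Set Implicit Arguments.
Unset Strict Implicit.
Unset Printing Implicit Defensive.
Import GRing.Theory Num.Theory.

(** * Components of induced subgraphs *)

(** Edges of the induced subgraph as a relation on all of [G], so that different sets [X] can be
    compared within one type. *)
Definition edge_in (G : sgraph) (X : {set G}) : rel G :=
  fun u v => [&& u \in X, v \in X & adj u v].

Definition conn (G : sgraph) (X : {set G}) : rel G := connect (edge_in X).

Definition ncomp_in (G : sgraph) (X : {set G}) : nat := ncomponents (induced X).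

Definition nbh (G : sgraph) (X : {set G}) (u : G) : {set G} :=
  [set v in X | adj u v].

(** Twice the number of edges induced on [X]. *)
Definition degsum (G : sgraph) (X : {set G}) : nat :=
  \sum_(u in X) #|nbh X u|.

Section Components.

Variable G : sgraph.
Implicit Types (X Y : {set G}) (u v : G).

Lemma edge_in_sym X : symmetric (edge_in X).
Proof. by move=> u v; rewrite /edge_in adj_sym andbCA. Qed.

Lemma conn_csym X : connect_sym (edge_in X).
Proof. exact/sym_connect_sym/edge_in_sym. Qed.

Lemma conn_sym X : symmetric (conn X).
Proof. exact: conn_csym. Qed.

Lemma conn_trans X : transitive (conn X).
Proof. exact: connect_trans. Qed.

Lemma conn_adj X u v : u \in X -> v \in X -> adj u v -> conn X u v.
Proof. by move=> uX vX uv; apply: connect1; rewrite /edge_in uX vX. Qed.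

Lemma conn_mono X Y u v : X \subset Y -> conn X u v -> conn Y u v.
Proof.
move=> XY; apply: connect_sub => x y /and3P[xX yX xy].
by apply: conn_adj; rewrite ?(subsetP XY).
Qed.

Lemma conn_label (T : Type) (f : G -> T) X u v :
  (forall x y, x \in X -> y \in X -> adj x y -> f x = f y) ->
  conn X u v -> f u = f v.
Proof.
move=> fX /connectP[p]; elim: p u => [|w p IH] u /= => [_ -> //|].
by case/andP=> /and3P[uX wX uw] pw vE; rewrite (fX _ _ uX wX uw) (IH w).
Qed.

Lemma conn_in X u v : conn X u v -> (u \in X) = (v \in X).
Proof. by apply: (conn_label (f := fun x => x \in X)) => x y -> ->. Qed.

(** The inclusion of the subtype is an adjunction between the two relations, so components can be
    counted by their roots in [G]. *)
Lemma ncomp_inE X : ncomp_in X = #|[set fingraph.root (edge_in X) x | x in X]|.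
Proof.
have adj_sym' : connect_sym (@adj (induced X)) by apply/sym_connect_sym/adj_sym.
have cl : closed (edge_in X) X by move=> x y /and3P[-> ->].
have adjn : rel_adjunction val (edge_in X) (@adj (induced X)) X.
  apply: (strict_adjunction adj_sym' cl); first exact: val_inj.
    by apply/subsetP=> x xX; apply/codomP; exists (exist _ x xX).
  by move=> u v _; rewrite /edge_in (valP u) (valP v).
rewrite /ncomp_in /ncomponents.
rewrite (_ : n_comp _ _ = n_comp (@adj (induced X)) [preim val of X]); last first.
  by apply: eq_card => -[x xX]; rewrite !inE /= xX.
rewrite -(adjunction_n_comp val (conn_csym X) adj_sym' cl adjn).
apply: eq_card => r; rewrite !inE /=; apply/andP/imsetP.
  by case=> /eqP rr rX; exists r.
case=> x xX ->; split; first exact/roots_root/conn_csym.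
by rewrite -(conn_in (connect_root _ x)).
Qed.

(** A labelling that is constant along edges factors through the component roots. *)
Lemma ncomp_in_ge (T : finType) (f : G -> T) X :
  (forall x y, x \in X -> y \in X -> adj x y -> f x = f y) ->
  #|f @: X| <= ncomp_in X.
Proof.
move=> fX; rewrite ncomp_inE.
suff -> : f @: X = f @: [set fingraph.root (edge_in X) x | x in X].
  exact: leq_imset_card.
rewrite -imset_comp; apply: eq_in_imset => x xX /=.
exact: (conn_label fX) (connect_root _ _).
Qed.

Lemma ncomp_in_le (R : {set G}) X :
  (forall x, x \in X -> exists2 r, r \in R & conn X x r) ->
  ncomp_in X <= #|R|.
Proof.
move=> RX; rewrite ncomp_inE.
apply: leq_trans (leq_imset_card (fingraph.root (edge_in X)) R).
apply/subset_leq_card/subsetP=> _ /imsetP[x xX ->].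
have [r rR xr] := RX x xX; apply/imsetP; exists r => //.
exact/(fingraph.rootP (conn_csym X)).
Qed.

Lemma ncomp_in0 : ncomp_in (set0 : {set G}) = 0.
Proof. by apply/eqP; rewrite ncomp_inE imset0 cards0. Qed.

Lemma ncomp_in_gt0 X x : x \in X -> 0 < ncomp_in X.
Proof. by move=> xX; rewrite ncomp_inE; apply/card_gt0P; eexists; apply: imset_f xX. Qed.

Lemma ncomp_in_le1 X x :
  (forall y, y \in X -> conn X y x) -> ncomp_in X <= 1.
Proof.
by move=> Xx; rewrite -(cards1 x); apply: ncomp_in_le => y /Xx; exists x; rewrite ?set11.
Qed.

Lemma conn_of_ncomp_in_le1 X x y :
  ncomp_in X <= 1 -> x \in X -> y \in X -> conn X x y.
Proof.
rewrite ncomp_inE => /card_le1_eqP h xX yX.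
by apply/(fingraph.rootP (conn_csym X)); apply: h; apply: imset_f.
Qed.

Lemma ncomp_in_le2 X :
  (forall x y z, x \in X -> y \in X -> z \in X ->
     [|| conn X x y, conn X y z | conn X x z]) -> ncomp_in X <= 2.
Proof.
move=> h; rewrite leqNgt ncomp_inE; apply/negP.
case/card_gt2P=> a [b] [c] [] [/imsetP[x xX ->] /imsetP[y yX ->] /imsetP[z zX ->]].
case; rewrite !(root_connect (conn_csym X)) => /negbTE xy /negbTE yz /negbTE zx.
by have := h x y z xX yX zX; rewrite /conn xy yz conn_csym zx.
Qed.

Lemma nbh_sub X u : nbh X u \subset X.
Proof. by apply/subsetP=> x; rewrite inE => /andP[]. Qed.

(* The label [None] merges [v] with the components of [X] that it meets. *)
Lemma ncomp_in_add_ge X v :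
  v \notin X -> (ncomp_in X).+1 <= ncomp_in (v |: X) + #|nbh X v|.
Proof.
move=> vX; pose r := fingraph.root (edge_in X); pose B := r @: nbh X v.
pose f x := if (x == v) || (r x \in B) then None else Some (r x).
have fE x y : x \in v |: X -> y \in v |: X -> adj x y -> f x = f y.
  have nv z : z \in X -> adj v z -> f z = None.
    by move=> zX vz; rewrite /f (imset_f r) ?orbT // inE zX.
  have fv : f v = None by rewrite /f eqxx.
  case/setU1P=> [->|xX] /setU1P[->|yX] xy //.
  - by rewrite fv nv.
  - by rewrite fv nv // adj_sym.
  have xv : (x == v) = false by apply: contraNF vX => /eqP <-.
  have yv : (y == v) = false by apply: contraNF vX => /eqP <-.
  by rewrite /f xv yv (_ : r x = r y) //; apply/(fingraph.rootP (conn_csym X))/conn_adj.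
apply: leq_trans (leq_add (ncomp_in_ge fE) (leqnn _)).
have sub : None |: Some @: (r @: X :\: B) \subset f @: (v |: X).
  apply/subsetP=> z /setU1P[->|/imsetP[w /setDP[/imsetP[x xX ->] xB] ->]].
    by apply/imsetP; exists v; rewrite ?setU11 // /f eqxx.
  apply/imsetP; exists x; first by rewrite inE xX orbT.
  rewrite /f (negbTE xB) orbF ifN //.
  by apply: contraNneq vX => <-.
apply: leq_trans (leq_add (subset_leq_card sub) (leqnn _)).
rewrite cardsU1 (_ : None \notin _); last by apply/imsetP=> -[].
rewrite card_imset; last by move=> ? ? [].
have := leq_imset_card r (nbh X v); rewrite -/B => Bn.
have KE : ncomp_in X = #|r @: X| by exact: ncomp_inE.
have := cardsID B (r @: X).
have := subset_leq_card (subsetIr (r @: X) B); rewrite -KE; lia.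
Qed.

(** Without neighbours in [X], [v] adds at most one component; with a single neighbour it joins the
    component of that neighbour. *)
Lemma ncomp_in_add_le X v :
  #|nbh X v| <= 1 -> ncomp_in (v |: X) + #|nbh X v| <= (ncomp_in X).+1.
Proof.
move=> dv; pose R := [set fingraph.root (edge_in X) x | x in X].
have XR x : x \in X -> exists2 r, r \in R & conn (v |: X) x r.
  move=> xX; exists (fingraph.root (edge_in X) x); first exact: imset_f.
  exact: conn_mono (subsetUr _ _) (connect_root _ _).
have [n0|[a]] := set_0Vmem (nbh X v).
  rewrite n0 cards0 addn0 (ncomp_inE X) -/R.
  apply: leq_trans (_ : #|v |: R| <= _); last by rewrite cardsU1 -[leqRHS]add1n leq_add2r leq_b1.
  apply: ncomp_in_le => x /setU1P[->|/XR[r rR xr]]; first by exists v; rewrite ?setU11 //; apply: connect0.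
  by exists r; rewrite // inE rR orbT.
rewrite inE => /andP[aX va].
apply: leq_trans (leq_add (leqnn _) dv) _; rewrite addn1 ltnS (ncomp_inE X) -/R.
apply: ncomp_in_le => x /setU1P[->|/XR //].
have [r rR ar] := XR a aX; exists r => //; apply: conn_trans ar.
by apply: conn_adj; rewrite ?inE ?eqxx ?aX ?orbT.
Qed.

Lemma nbhU1 X v w : v \notin X ->
  #|nbh (v |: X) w| = adj w v + #|nbh X w|.
Proof.
move=> vX; have -> : nbh (v |: X) w = if adj w v then v |: nbh X w else nbh X w.
  apply/setP=> z; case: ifPn => wv; rewrite !inE; case: eqP => //= ->.
    by rewrite wv.
  by rewrite (negbTE wv) andbF.
by case: ifP => _; rewrite ?cardsU1 // inE negb_and vX.
Qed.

Lemma degsumU1 X v : v \notin X -> degsum (v |: X) = degsum X + 2 * #|nbh X v|.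
Proof.
move=> vX; rewrite /degsum big_setU1 //= nbhU1 // adj_irr add0n.
rewrite (eq_bigr (fun u => adj v u + #|nbh X u|)); last first.
  by move=> u _; rewrite nbhU1 // adj_sym.
rewrite big_split /= [X in _ + (X + _) = _](_ : _ = #|nbh X v|); first by lia.
rewrite -sum1_card big_mkcond [RHS]big_mkcond /=.
by apply: eq_bigr => u _; rewrite inE; case: (u \in X); case: adj.
Qed.

Lemma degsum0 : degsum (set0 : {set G}) = 0.
Proof. by rewrite /degsum big_set0. Qed.

(** Components are at least vertices minus edges, doubled since [degsum] counts edges twice. The
    induction removes an arbitrary vertex. *)
Lemma euler_ge X : 2 * #|X| <= 2 * ncomp_in X + degsum X.
Proof.
have [k] := ubnP #|X|; elim: k X => // k IH X Xk.
have [->|[v vX]] := set_0Vmem X; first by rewrite cards0.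
have vD : v \notin X :\ v by rewrite !inE eqxx.
have := ncomp_in_add_ge vD; have := degsumU1 vD; rewrite setD1K //.
by have := IH (X :\ v); move: Xk; rewrite (cardsD1 v X) vX; lia.
Qed.

(** The hypothesis says that [X] induces a forest; removing vertices of degree at most 1 one by one
    keeps Euler's formula exact. *)
Lemma euler_forest X :
  (forall Y, Y \subset X -> Y != set0 -> exists2 v, v \in Y & #|nbh Y v| <= 1) ->
  2 * ncomp_in X + degsum X = 2 * #|X|.
Proof.
move=> forX; apply/eqP; rewrite eqn_leq euler_ge andbT; move: forX.
have [k] := ubnP #|X|; elim: k X => // k IH X Xk forX.
have [->|] := eqVneq X set0; first by rewrite ncomp_in0 degsum0.
case/(forX _ (subxx X)) => v vX dv.
have vD : v \notin X :\ v by rewrite !inE eqxx.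
have nD : nbh (X :\ v) v = nbh X v.
  apply/setP=> z; rewrite !inE; case: eqP => //= ->.
  by rewrite adj_irr andbF.
have : #|nbh (X :\ v) v| <= 1 by rewrite nD.
move/ncomp_in_add_le; have := degsumU1 vD; rewrite setD1K // nD.
have := IH (X :\ v); move: Xk; rewrite (cardsD1 v X) vX => Xk /(_ _ _).
have h1 : #|X :\ v| < k by lia.
move/(_ h1) => IH1.
have h2 : forall Y, Y \subset X :\ v -> Y != set0 -> exists2 v0, v0 \in Y & #|nbh Y v0| <= 1.
  by move=> Y YX; apply: forX; apply: subset_trans YX (subD1set _ _).
move/(_ h2): IH1; lia.
Qed.

End Components.

(** * Vertex sets recorded by the polynomial *)

Lemma coef_subgraph_component_poly (G : sgraph) (i j : nat) :
  ((subgraph_component_poly G)`_j`_i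
  = (#|[set X : {set G} | (#|X| == i) && (ncomp_in X == j)]|%:R))%R.
Proof.
rewrite -sum1_card natr_sum !coef_sum.
rewrite [RHS]big_mkcond; apply: eq_bigr => X _; rewrite inE.
rewrite /varx /vary -rmorphXn mul_polyC coefZ coefXn -/(ncomp_in X) [j == _]eq_sym.
case: (_ == j); rewrite ?andbF ?mulr0 ?coef0 // andbT mulr1 coefXn eq_sym.
by case: (_ == _).
Qed.

(** Equal coefficients mean that the pairs (size, number of components) form the same multiset in
    both graphs. *)
Lemma subgraph_component_poly_sum (G H : sgraph) (F : nat -> nat -> nat) :
  subgraph_component_poly H = subgraph_component_poly G ->
  \sum_(X : {set H}) F #|X| (ncomp_in X) = \sum_(X : {set G}) F #|X| (ncomp_in X).
Proof.
move=> PE; pose pr (K : sgraph) (X : {set K}) := (#|X|, ncomp_in X).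
have cE (K : sgraph) a : count_mem a (map (@pr K) (index_enum _)) =
    #|[set X : {set K} | (#|X| == a.1) && (ncomp_in X == a.2)]|.
  rewrite count_map -sum1_card -sum1_count; apply: eq_bigl => X.
  by rewrite inE; case: a.
have perm : perm_eq (map (@pr H) (index_enum _)) (map (@pr G) (index_enum _)).
  apply/allP=> a _ /=; rewrite !cE; apply/eqP.
  have := coef_subgraph_component_poly H a.1 a.2.
  by rewrite PE coef_subgraph_component_poly => /eqP; rewrite eqr_nat => /eqP.
have sE (K : sgraph) : \sum_(X : {set K}) F #|X| (ncomp_in X) =
    \sum_(a <- map (@pr K) (index_enum _)) F a.1 a.2 by rewrite big_map.
by rewrite !sE; apply: perm_big.
Qed.

(** The number of sets violating [P] is a sum determined by the polynomial, and it is zero for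
    [G]. *)
Lemma subgraph_component_poly_all (G H : sgraph) (P : nat -> nat -> bool) :
  subgraph_component_poly H = subgraph_component_poly G ->
  (forall X : {set G}, P #|X| (ncomp_in X)) ->
  (forall X : {set H}, P #|X| (ncomp_in X)).
Proof.
move=> PE PG X.
have := subgraph_component_poly_sum (fun i j => ~~ P i j : nat) PE.
rewrite [RHS]big1 => [/eqP|Y _]; last by rewrite PG.
by rewrite sum_nat_eq0 => /forallP/(_ X); case: (P _ _).
Qed.

(** * The cube *)

(** Cubes built by doubling: two disjoint cubes joined by the perfect matching [f]. This is the form
    suited to induction on the dimension. *)
Inductive cubeset (G : sgraph) : nat -> {set G} -> Prop :=
| CubesetPoint (x : G) : cubeset 0 [set x]
| CubesetDouble (k : nat) (A B : {set G}) (f : G -> G) :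
    cubeset k A -> cubeset k B -> [disjoint A & B] -> involutive f ->
    (forall x, x \in A -> f x \in B) -> (forall x, x \in B -> f x \in A) ->
    (forall x, adj x (f x)) -> cubeset k.+1 (A :|: B).

(** * Connectivity of cubes after deleting the vertices outside [X] *)

Section Cubeset.

Variable G : sgraph.
Implicit Types (A B X : {set G}).

Lemma card_cubeset k A : cubeset k A -> #|A| = 2 ^ k.
Proof.
elim=> [x|k' A' B f _ IA _ IB dAB _ _ _ _]; first by rewrite cards1.
by rewrite cardsU (disjoint_setI0 dAB) cards0 IA IB expnS; lia.
Qed.

Lemma cubeset_missing (A B X : {set G}) : [disjoint A & B] ->
  #|(A :|: B) :\: X| = #|A :\: X| + #|B :\: X|.
Proof.
move=> dAB; rewrite setDUl cardsU -setDIl (disjoint_setI0 dAB).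
by rewrite set0D cards0 subn0.
Qed.

(** [f] injects the remaining vertices of [A] into the deleted ones of [B]. *)
Lemma card_setD_inj (A B X : {set G}) (f : G -> G) : injective f ->
  (forall x, x \in A -> x \in X -> f x \in B :\: X) ->
  #|A| <= #|A :\: X| + #|B :\: X|.
Proof.
move=> fI fAB; rewrite -(cardsID X A) addnC leq_add2l -(card_imset _ fI).
apply/subset_leq_card/subsetP=> _ /imsetP[x /setIP[xA xX] ->].
exact: fAB.
Qed.

(** If one half is intact, all remaining vertices reach it along the matching. Otherwise each half
    has at most [k'.-1] deletions, is connected by induction, and a surviving matching edge joins
    the two. *)
Lemma cubeset_connected k A : cubeset k A -> forall X,
  #|A :\: X| <= k.-1 -> forall x y, x \in X :&: A -> y \in X :&: A -> conn X x y.
Proof.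
elim=> [z|k' {}A B f cA IA cB IB dAB ff fA fB af] X.
  by move=> _ x y /setIP[_ /set1P->] /setIP[_ /set1P->]; apply: connect0.
rewrite cubeset_missing // => AB.
have toC x (C : {set G}) : x \in X -> f x \in C -> #|C :\: X| = 0 -> conn X x (f x) /\ f x \in X :&: C.
  move=> xX fC /eqP; rewrite cards_eq0 setD_eq0 => /subsetP CX.
  by have fX := CX _ fC; rewrite inE fC fX; split=> //; apply: conn_adj.
have solve (C D : {set G}) : (forall x, x \in D -> f x \in C) -> #|C :\: X| = 0 ->
    (forall x y, x \in X :&: C -> y \in X :&: C -> conn X x y) ->
    forall x y, x \in X :&: (C :|: D) -> y \in X :&: (C :|: D) -> conn X x y.
  move=> fD C0 IC.
  have go x : x \in X :&: (C :|: D) -> exists2 z, conn X x z & z \in X :&: C.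
    case/setIP=> xX /setUP[xC|xD]; first by exists x; rewrite ?inE ?xX //; apply: connect0.
    by have [] := toC x C xX (fD _ xD) C0; exists (f x).
  move=> x y /go[z xz zC] /go[t yt tC].
  apply: conn_trans xz _; apply: conn_trans (IC _ _ zC tC) _.
  by rewrite conn_sym.
have [B0|Bn0] := eqVneq #|B :\: X| 0.
  by rewrite [A :|: B]setUC; apply: solve => //; apply: IB; rewrite B0.
have [A0|An0] := eqVneq #|A :\: X| 0.
  by apply: solve => //; apply: IA; rewrite A0.
have cX : #|A :\: X| <= k'.-1 by lia.
have dX : #|B :\: X| <= k'.-1 by lia.
(* There are [2 ^ k'] matching edges and at most [k'] deletions. *)
have [t tA /andP[tX ftX]] : exists2 t, t \in A & (t \in X) && (f t \in X).
  apply/exists_inP; apply: contraT; rewrite negb_exists_in => /forall_inP h.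
  have : #|A| <= #|A :\: X| + #|B :\: X|.
    apply: (card_setD_inj (inv_inj ff)) => x xA xX.
    by have := h _ xA; rewrite inE xX fA // andbT.
  rewrite (card_cubeset cA); have := ltn_expl k' (ltnSn 1); lia.
have go x : x \in X :&: (A :|: B) -> conn X x t.
  case/setIP=> xX /setUP[xA|xB]; first by apply: IA; rewrite // inE ?xX ?tX.
  apply: conn_trans (_ : conn X x (f t)) _.
    by apply: IB; rewrite // inE ?xX ?ftX ?fA.
  by rewrite conn_sym; apply: conn_adj.
by move=> x y /go xt /go yt; apply: conn_trans xt _; rewrite conn_sym.
Qed.

(* If the half with fewer deleted vertices is connected, a component avoiding it
   lies in the other half [C] and all its partners under [f] are deleted. *)
Lemma cubeset_two_comps k A : cubeset k A -> forall X,
  #|A :\: X| + 3 <= 2 * k -> forall x y z,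
  x \in X :&: A -> y \in X :&: A -> z \in X :&: A ->
  [|| conn X x y, conn X y z | conn X x z].
Proof.
elim=> [z|k' {}A B f cA IA cB IB dAB ff fA fB af] X; first by rewrite addn3.
rewrite cubeset_missing // => AB.
have solve (C D : {set G}) : cubeset k' C ->
    (forall X, #|C :\: X| + 3 <= 2 * k' -> forall x y z,
      x \in X :&: C -> y \in X :&: C -> z \in X :&: C ->
      [|| conn X x y, conn X y z | conn X x z]) ->
    (forall x, x \in C -> f x \in D) -> #|C :\: X| + #|D :\: X| + 3 <= 2 * k'.+1 ->
    (forall x y, x \in X :&: D -> y \in X :&: D -> conn X x y) ->
    #|D :\: X| <= k'.-1 ->
    forall x y z, x \in X :&: (C :|: D) -> y \in X :&: (C :|: D) ->
    z \in X :&: (C :|: D) -> [|| conn X x y, conn X y z | conn X x z].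
  move=> cC IC fC CD ID D1.
  (* The [good] vertices reach the connected half [D], so they form at most one component. *)
  pose good x := [exists y in X :&: D, conn X x y].
  have goodD x : x \in X :&: D -> good x.
    by move=> xD; apply/exists_inP; exists x => //; apply: connect0.
  have good_conn x y : good x -> good y -> conn X x y.
    case/exists_inP=> x' x'D xx' /exists_inP[y' y'D yy'].
    by apply: conn_trans xx' _; apply: conn_trans (ID _ _ x'D y'D) _; rewrite conn_sym.
  have badC x : x \in X :&: (C :|: D) -> ~~ good x ->
      x \in X :&: C /\ f x \in D :\: X.
    case/setIP=> xX /setUP[xC|xD] bx; last by rewrite goodD // inE xX in bx.
    rewrite !inE xX xC fC //; split; rewrite ?andbT //; apply: contraNN bx => fX.
    apply/exists_inP; exists (f x); first by rewrite inE fX fC.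
    exact: conn_adj.
  have bad_conn x y : x \in X :&: (C :|: D) -> y \in X :&: (C :|: D) ->
      ~~ good x -> ~~ good y -> conn X x y.
    move=> xCD yCD bx by_; have [xC fx] := badC _ xCD bx; have [yC fy] := badC _ yCD by_.
    (* With at most one deletion in [D], two bad vertices have the same deleted partner and
       coincide. *)
    have [D2|D2] := leqP #|D :\: X| 1.
      have := card_le1_eqP D2 _ _ fx fy.
      by move/(inv_inj ff)->; apply: connect0.
    have C3 : #|C :\: X| + 3 <= 2 * k' by lia.
    (* Otherwise, by induction, every remaining vertex of [C] is connected to [x] or [y], hence bad.
       This takes at least [2 ^ k'] deletions, but there are fewer than [2 * k']. *)
    apply: contraT => xy.
    have : #|C| <= #|C :\: X| + #|D :\: X|.
      apply: (card_setD_inj (inv_inj ff)) => t tC tX.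
      have tXC : t \in X :&: C by rewrite inE tX.
      have tCD : t \in X :&: (C :|: D) by rewrite !inE tX tC.
      suff bt : ~~ good t by case: (badC _ tCD bt).
      have goodE u : conn X u t -> good t -> good u.
        move=> ut /exists_inP[w wD tw]; apply/exists_inP; exists w => //.
        exact: conn_trans ut tw.
      have /or3P[|yt|xt] := IC X C3 x y t xC yC tXC; first by rewrite (negbTE xy).
        by apply: contraNN by_; apply: goodE.
      by apply: contraNN bx; apply: goodE.
    rewrite (card_cubeset cC).
    have : 2 * k' <= 2 ^ k' by case: (k') => // m; rewrite expnS leq_mul2l ltn_expl.
    lia.
  move=> x y z xX yX zX.
  have same u v : u \in X :&: (C :|: D) -> v \in X :&: (C :|: D) ->
      good u = good v -> conn X u v.
    move=> uX vX uv; have [gu|bu] := boolP (good u); first by apply: good_conn; rewrite -?uv.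
    by apply: bad_conn; rewrite -?uv.
  have [xy|xy] := eqVneq (good x) (good y); first by rewrite same.
  have [yz|yz] := eqVneq (good y) (good z); first by rewrite (same y z) ?orbT.
  rewrite (same x z) ?orbT //.
  by case: (good x) (good y) (good z) xy yz => [] [] [].
(* With fewer than [2 * k'] deletions in all, one half has at most [k'.-1]. *)
have [B1|B1] := leqP #|B :\: X| k'.-1.
  by apply: solve => //; move=> x y; apply: (cubeset_connected cB).
rewrite [A :|: B]setUC; apply: solve => //; try lia.
by apply: (cubeset_connected cA); lia.
Qed.

End Cubeset.

Definition common_nbh (G : sgraph) (u v : G) : {set G} :=
  [set w | adj u w && adj v w].

Definition triangle_free (G : sgraph) : Prop :=
  forall u v w : G, adj u v -> adj v w -> adj u w = false.

(** * Adjacency, common neighbours and faces of the cube *)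

Section CubeFacts.

Variable n : nat.
Implicit Types (u v w : cube n) (i j k : 'I_n).

Definition flip i u : cube n := [ffun j => (j == i) (+) u j].

Lemma flipE i u j : flip i u j = (j == i) (+) u j.
Proof. by rewrite ffunE. Qed.

Lemma flipK i : involutive (flip i).
Proof. by move=> u; apply/ffunP=> j; rewrite !flipE addbA addbb. Qed.

Lemma flipC i j u : flip i (flip j u) = flip j (flip i u).
Proof. by apply/ffunP=> k; rewrite !flipE addbCA. Qed.

Lemma flip_injl u : injective (flip^~ u).
Proof.
move=> i j /ffunP/(_ i); rewrite !flipE eqxx /=.
by case: eqP => //= _; case: (u i).
Qed.

Lemma cube_adjP u v : reflect (exists i, v = flip i u) (adj u v).
Proof.
apply: (iffP (cards1P (A := [set i | u i != v i]))) => -[i].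
  move/setP=> uv; exists i; apply/ffunP=> j; have := uv j.
  by rewrite !inE flipE => <-; case: (u j) (v j) => [] [].
move=> ->; exists i; apply/setP=> j; rewrite !inE flipE.
by case: (j == i) (u j) => [] [].
Qed.

Lemma cube_adj_flip i u : adj u (flip i u).
Proof. by apply/cube_adjP; exists i. Qed.

Lemma cube_regular u : #|nbh setT u| = n.
Proof.
rewrite -[RHS]card_ord -cardsT -(card_imset _ (@flip_injl u)).
apply: eq_card => v; rewrite !inE /=.
by apply/cube_adjP/imsetP=> [[i ->]|[i _ ->]]; exists i.
Qed.

Definition parity u : bool := \big[addb/false]_i u i.

Lemma parity_flip i u : parity (flip i u) = ~~ parity u.
Proof.
rewrite /parity (bigD1 i) //= [X in ~~ X](bigD1 i) //= flipE eqxx /= addNb.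
congr (~~ (_ (+) _)).
by apply: eq_bigr => j /negbTE ji; rewrite flipE ji.
Qed.

(** [parity] is a proper 2-colouring. *)
Lemma cube_triangle_free : triangle_free (cube n).
Proof.
move=> u v w /cube_adjP[i ->] /cube_adjP[j ->]; apply/negP => /cube_adjP[k].
move/(congr1 parity); rewrite !parity_flip negbK.
by case: parity.
Qed.

(** A common neighbour shows that [u] and [v] differ by two flips [i] and [j]; the common neighbours
    arise by performing just one of them. *)
Lemma cube_common_nbh u v : u != v ->
  #|common_nbh u v| = 0 \/ #|common_nbh u v| = 2.
Proof.
move=> uv; have [->|[w]] := set_0Vmem (common_nbh u v); first by left; rewrite cards0.
rewrite inE adj_sym [adj v w]adj_sym => /andP[/cube_adjP[i uE] /cube_adjP[j vE]]; right.
have ij : i != j by apply: contraNneq uv => ij; rewrite uE vE ij.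
have {}vE : v = flip j (flip i u) by rewrite uE flipK.
suff -> : common_nbh u v = [set flip i u; flip j u].
  by rewrite cards2 (inj_eq (@flip_injl u)) ij.
apply/setP=> x; rewrite !inE; apply/andP/orP; last first.
  case=> /eqP->; rewrite cube_adj_flip adj_sym vE; first by rewrite cube_adj_flip.
  by rewrite flipC cube_adj_flip.
case=> /cube_adjP[k ->]; rewrite adj_sym => /cube_adjP[l]; rewrite vE => /ffunP E.
rewrite !(inj_eq (@flip_injl u)).
have := E i; have := E j; rewrite !flipE !eqxx [j == i]eq_sym (negbTE ij) /=.
rewrite ![_ == k]eq_sym; have [kj|kj] := eqVneq k j; first by move=> *; right; rewrite ?kj.
have [ki|ki] := eqVneq k i; first by move=> *; left; rewrite ?ki.
(* With [k] distinct from both, [l] would have to equal [i] and [j] at once. *)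
case: eqP => [<-|]; last by case: (u j).
by rewrite (negbTE ij); case: (u i).
Qed.

Definition face (m : nat) u : {set cube n} :=
  [set v : cube n | [forall i : 'I_n, (m <= i) ==> (v i == u i)]].

(** Freeing the coordinate [i0] doubles a face, and [flip i0] matches the two halves. *)
Lemma face_cubeset m u : m <= n -> cubeset m (face m u).
Proof.
elim: m u => [|m IH] u mn.
  rewrite (_ : face 0 u = [set u]); first exact: CubesetPoint.
  apply/setP=> v; rewrite !inE; apply/forallP/eqP => [h|-> i]; last by rewrite eqxx.
  by apply/ffunP=> i; apply/eqP/h.
pose i0 := Ordinal mn.
have -> : face m.+1 u = face m u :|: face m (flip i0 u).
  apply/setP=> v; rewrite !inE.
  apply/forallP/orP => [h|[] /forallP h i]; last 2 first.
  - by apply/implyP=> mi; apply: (implyP (h i)); apply: ltnW.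
  - apply/implyP=> mi; have := implyP (h i) (ltnW mi); rewrite flipE.
    by rewrite (_ : i == i0 = false) //; apply/negbTE; rewrite -val_eqE /= neq_ltn mi orbT.
  have hh i : (m <= i) -> i != i0 -> v i == u i.
    move=> mi ii; apply: (implyP (h i)); rewrite ltn_neqAle mi andbT eq_sym.
    by rewrite -val_eqE in ii.
  have [vu|vu] := eqVneq (v i0) (u i0); [left|right]; apply/forallP=> i; apply/implyP=> mi.
    by have [->|ii] := eqVneq i i0; [apply/eqP | apply: hh].
  rewrite flipE; have [->|ii] := eqVneq i i0; last exact: hh.
  by case: (v i0) (u i0) vu => [] [].
have fl z v : v \in face m z -> flip i0 v \in face m (flip i0 z).
  rewrite !inE => /forallP h; apply/forallP=> i; apply/implyP=> mi.
  by rewrite !flipE (eqP (implyP (h i) mi)).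
apply: (CubesetDouble (f := flip i0)).
- exact: IH (ltnW mn).
- exact: IH (ltnW mn).
- rewrite -setI_eq0; apply/eqP/setP=> v; rewrite !inE.
  apply/negP=> /andP[/forallP/(_ i0) + /forallP/(_ i0)].
  by rewrite leqnn flipE eqxx => /eqP->; case: (u i0).
- exact: flipK.
- exact: fl.
- by move=> x /fl; rewrite flipK.
- exact: cube_adj_flip.
Qed.

Lemma cube_cubeset : cubeset n [set: cube n].
Proof.
have := face_cubeset [ffun=> false] (leqnn n); congr cubeset.
apply/setP=> v; rewrite !inE; apply/forallP=> i.
by rewrite leqNgt ltn_ord.
Qed.

Lemma card_cube : #|cube n| = 2 ^ n.
Proof. by rewrite -cardsT; apply/card_cubeset/cube_cubeset. Qed.

Lemma cube_ncomp_le1 (X : {set cube n}) : #|~: X| <= n.-1 -> ncomp_in X <= 1.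
Proof.
rewrite -setTD => nX; have [->|[x xX]] := set_0Vmem X; first by rewrite ncomp_in0.
apply: (ncomp_in_le1 (x := x)) => y yX.
by apply: (cubeset_connected cube_cubeset nX); rewrite inE ?xX ?yX inE.
Qed.

Lemma cube_ncomp_le2 (X : {set cube n}) : #|~: X| + 3 <= 2 * n -> ncomp_in X <= 2.
Proof.
rewrite -setTD => nX; apply: ncomp_in_le2 => x y z xX yX zX.
by apply: (cubeset_two_comps cube_cubeset nX); rewrite inE ?xX ?yX ?zX inE.
Qed.

End CubeFacts.

(** * Vertex sets of size at most four *)

(** One strict term would make the sums differ. This turns global counts into statements about each
    vertex, pair or set. *)
Lemma leq_sum_eq (I : finType) (P : pred I) (E F : I -> nat) :
  (forall i, P i -> E i <= F i) ->
  \sum_(i | P i) E i = \sum_(i | P i) F i -> forall i, P i -> E i = F i.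
Proof.
move=> EF eqS i Pi; apply/eqP; rewrite eqn_leq EF //= leqNgt; apply/negP => lt.
have : \sum_(j | P j) E j < \sum_(j | P j) F j; last by rewrite eqS ltnn.
rewrite (bigD1 i) // [X in _ < X](bigD1 i) //= -addSn leq_add //.
by apply: leq_sum => j /andP[/EF].
Qed.

(** Such an [X] is determined by [X :\: P], an arbitrary [k]-subset of [A]. *)
Lemma card_supersets (T : finType) (P A : {set T}) (k : nat) :
  [disjoint P & A] ->
  #|[set X : {set T} | [&& P \subset X, X :\: P \subset A & #|X| == #|P| + k]]|
  = 'C(#|A|, k).
Proof.
move=> dPA; rewrite -cards_draws.
rewrite -[RHS](card_in_imset (f := fun B => P :|: B)).
  apply: eq_card => X; rewrite inE; apply/and3P/imsetP.
    case=> PX XA /eqP Xk; exists (X :\: P); last by rewrite -{1}(setID X P) (setIidPr PX).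
    by rewrite inE XA cardsDS // Xk addKn eqxx.
  case=> B; rewrite inE => /andP[BA /eqP Bk] ->; split; first exact: subsetUl.
    rewrite setDUl setDv set0U; exact: subset_trans (subsetDl _ _) BA.
  rewrite cardsU (_ : P :&: B = set0) ?cards0 ?subn0 ?Bk //.
  by apply/disjoint_setI0; apply: disjointWr dPA.
have dB B : B \in [set B : {set T} | B \subset A & #|B| == k] -> (P :|: B) :\: P = B.
  rewrite inE => /andP[BA _]; rewrite setDUl setDv set0U.
  by apply/setDidPl; rewrite disjoint_sym; apply: disjointWr dPA.
by move=> B C /dB {2}<- /dB {2}<- ->.
Qed.

Lemma degsumE (G : sgraph) (X : {set G}) :
  degsum X = \sum_(u : G) \sum_(v | adj u v) (u \in X) && (v \in X).
Proof.
rewrite /degsum big_mkcond; apply: eq_bigr => u _; case: ifP => uX; last by rewrite big1.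
rewrite -sum1_card big_mkcond [RHS]big_mkcond; apply: eq_bigr => v _ /=.
by rewrite inE; case: (v \in X); case: adj.
Qed.

(** Double counting: each ordered adjacent pair lies in ['C(#|G| - 2, k)] sets of size [k.+2]. *)
Lemma sum_degsum (G : sgraph) (k : nat) :
  \sum_(X : {set G} | #|X| == k.+2) degsum X = degsum [set: G] * 'C(#|G| - 2, k).
Proof.
under eq_bigr do rewrite degsumE.
rewrite exchange_big degsumE big_distrl; apply: eq_bigr => u _ /=.
rewrite exchange_big big_distrl; apply: eq_bigr => v uv /=.
have uNv : u != v by apply: contraTneq uv => ->; rewrite adj_irr.
rewrite !inE mul1n -(_ : #|~: [set u; v]| = #|G| - 2); last first.
  by rewrite cardsCs setCK cards2 uNv.
rewrite -(card_supersets (P := [set u; v])); last by rewrite disjoints_subset setCK.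
rewrite -sum1_card big_mkcond [RHS]big_mkcond; apply: eq_bigr => X _ /=.
rewrite inE cards2 uNv add2n subUset !sub1set (_ : X :\: _ \subset _); last by rewrite setDE subsetIr.
by case: (u \in X); case: (v \in X); case: (_ == _).
Qed.

(* Ordered pairs of opposite vertices of the 4-cycles on a 4-set [X]; an induced
   4-cycle contributes 4. *)
Definition square_pairs (G : sgraph) (X : {set G}) : nat :=
  \sum_(u : G) \sum_(v | u != v)
     [&& [set u; v] \subset X & X :\: [set u; v] \subset common_nbh u v].

(** A 4-set with opposite vertices [u], [v] arises by adding two of their common neighbours. *)
Lemma sum_square_pairs (G : sgraph) :
  \sum_(X : {set G} | #|X| == 4) square_pairs X
  = \sum_(u : G) \sum_(v | u != v) 'C(#|common_nbh u v|, 2).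
Proof.
rewrite exchange_big; apply: eq_bigr => u _ /=.
rewrite exchange_big; apply: eq_bigr => v uNv /=.
rewrite -(card_supersets (P := [set u; v])); last first.
  rewrite -setI_eq0; apply/eqP/setP=> w; rewrite !inE; apply/negP=> /andP[/orP[]/eqP->];
  by rewrite adj_irr ?andbF.
rewrite -sum1_card big_mkcond [RHS]big_mkcond; apply: eq_bigr => X _ /=.
by rewrite inE cards2 uNv; case: (_ \subset _); case: (_ \subset _); case: (_ == _).
Qed.

(** * Euler's formula on two, three and four vertices *)

Section SmallSets.

Variable G : sgraph.
Implicit Types (X Y : {set G}) (u v : G).

Lemma card_nbh_lt Y u : u \in Y -> #|nbh Y u| < #|Y|.
Proof.
move=> uY; apply: proper_card; rewrite properE nbh_sub /=.
by apply/subsetPn; exists u; rewrite // inE uY adj_irr.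
Qed.

Lemma nbh_subW X Y u : Y \subset X -> #|nbh Y u| <= #|nbh X u|.
Proof.
move=> YX; apply/subset_leq_card/subsetP=> v; rewrite !inE => /andP[vY ->].
by rewrite (subsetP YX).
Qed.

Lemma euler_pair X : #|X| = 2 -> 2 * ncomp_in X + degsum X = 4.
Proof.
move=> X2; rewrite euler_forest ?X2 // => Y YX /set0Pn[v vY]; exists v => //.
by have := card_nbh_lt vY; have := subset_leq_card YX; lia.
Qed.

(** Three edges on three vertices make Euler's inequality strict. *)
Lemma euler_triangle u v w : adj u v -> adj v w -> adj u w ->
  #|[set u; v; w]| = 3 /\ 6 < 2 * ncomp_in [set u; v; w] + degsum [set u; v; w].
Proof.
move=> uv vw uw.
have neq (x y : G) : adj x y -> (x == y) = false by apply: contraTF => /eqP->; rewrite adj_irr.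
have X3 : #|[set u; v; w]| = 3.
  by rewrite setUC cardsU1 cards2 !inE (neq u v) // ![w == _]eq_sym !neq.
split=> //.
have uX : u \in [set u; v; w] by rewrite !inE eqxx.
have := ncomp_in_gt0 uX.
suff : 6 <= degsum [set u; v; w] by lia.
have -> : 6 = \sum_(x in [set u; v; w]) 2 by rewrite sum_nat_const X3.
apply: leq_sum => x; rewrite !inE -orbA => /or3P[]/eqP->.
- rewrite -(_ : #|[set v; w]| = 2); last by rewrite cards2 neq.
  by apply/subset_leq_card/subsetP=> y; rewrite !inE => /orP[]/eqP->; rewrite eqxx ?orbT ?uv ?uw.
- rewrite -(_ : #|[set u; w]| = 2); last by rewrite cards2 neq.
  by apply/subset_leq_card/subsetP=> y; rewrite !inE => /orP[]/eqP->; rewrite eqxx ?orbT ?vw // adj_sym.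
- rewrite -(_ : #|[set u; v]| = 2); last by rewrite cards2 neq.
  by apply/subset_leq_card/subsetP=> y; rewrite !inE => /orP[]/eqP->; rewrite eqxx ?orbT // adj_sym.
Qed.

Hypothesis tfG : triangle_free G.

Lemma card_nbh_adj Y u v : adj u v -> #|nbh Y u| + #|nbh Y v| <= #|Y|.
Proof.
move=> uv; apply: leq_trans (_ : #|nbh Y u :|: nbh Y v| <= _); last first.
  by apply/subset_leq_card; rewrite subUset !nbh_sub.
rewrite cardsU (_ : _ :&: _ = set0) ?cards0 ?subn0 //.
apply/setP=> w; rewrite !inE; apply/negP=> /andP[/andP[_ uw] /andP[_ vw]].
by rewrite (tfG uv vw) in uw.
Qed.

(** Adjacent vertices have disjoint neighbourhoods: if [x] has two neighbours in [Y], any neighbour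
    of [x] has at most one. *)
Lemma exists_leaf Y : #|Y| <= 3 -> Y != set0 -> exists2 v, v \in Y & #|nbh Y v| <= 1.
Proof.
move=> Y3 /set0Pn[x xY]; have [x1|x2] := leqP #|nbh Y x| 1; first by exists x.
have /card_gt0P[a] : 0 < #|nbh Y x| by lia.
rewrite inE => /andP[aY xa]; exists a => //.
by have := card_nbh_adj Y xa; lia.
Qed.

Lemma euler_triple X : #|X| = 3 -> 2 * ncomp_in X + degsum X = 6.
Proof.
move=> X3; rewrite euler_forest ?X3 // => Y YX; apply: exists_leaf.
by rewrite -X3 subset_leq_card.
Qed.

Lemma square_pair_nbh X u v w : u != v -> [set u; v] \subset X ->
  X :\: [set u; v] \subset common_nbh u v -> w \in X -> #|X| = 4 ->
  1 < #|nbh X w|.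
Proof.
move=> uv uvX /subsetP sub wX X4.
have X2 : #|X :\: [set u; v]| = 2 by rewrite cardsDS // X4 cards2 uv.
have [wuv|wuv] := boolP (w \in [set u; v]).
  rewrite -X2; apply/subset_leq_card/subsetP=> x xX.
  have := sub x xX; move: xX wuv; rewrite !inE => /andP[_ ->].
  by case/orP=> /eqP-> /andP[].
have : w \in common_nbh u v by apply: sub; rewrite inE wuv.
rewrite inE => /andP[uw vw]; rewrite (_ : 2 = #|[set u; v]|); last by rewrite cards2 uv.
apply/subset_leq_card/subsetP=> x xuv; rewrite inE (subsetP uvX) //=.
by move: xuv; rewrite !inE adj_sym => /orP[]/eqP->.
Qed.

(** [X] induces either a forest, where [square_pairs] vanishes, or a 4-cycle, with one component,
    degree sum 8 and four ordered opposite pairs. Doubling Euler's formula makes its defect equal to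
    [square_pairs]. *)
Lemma euler_square X : #|X| = 4 ->
  4 * ncomp_in X + 2 * degsum X = 16 + square_pairs X.
Proof.
move=> X4; have [/exists_inP[v vX dv]|] := boolP [exists v in X, #|nbh X v| <= 1].
  have -> : square_pairs X = 0.
    rewrite /square_pairs big1 // => a _; rewrite big1 // => b ab.
    apply/eqP; rewrite eqb0; apply/negP=> /andP[abX sub].
    by have := square_pair_nbh ab abX sub vX X4; rewrite ltnNge dv.
  suff : 2 * ncomp_in X + degsum X = 2 * #|X| by lia.
  apply: euler_forest => Y YX Yn0.
  have [vY|vY] := boolP (v \in Y).
    by exists v => //; apply: leq_trans dv; apply: nbh_subW.
  apply: exists_leaf => //.
  have : #|Y| <= #|X :\ v| by apply: subset_leq_card; rewrite subsetD1 YX.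
  by have := cardsD1 v X; rewrite vX X4; lia.
rewrite negb_exists_in => /forall_inP deg_gt1.
(* Adjacent degrees add up to at most 4, and each is at least 2. *)
have deg2 u : u \in X -> #|nbh X u| = 2.
  move=> uX; have := deg_gt1 _ uX; rewrite -ltnNge => u2.
  have /card_gt0P[v] : 0 < #|nbh X u| by lia.
  rewrite inE => /andP[vX uv]; have := card_nbh_adj X uv.
  by have := deg_gt1 _ vX; rewrite -ltnNge X4; lia.
have dX : degsum X = 8 by rewrite /degsum (eq_bigr _ deg2) sum_nat_const X4.
have nonadj u v : u \in X -> v \in X -> u != v -> ~~ adj u v -> nbh X u = X :\: [set u; v].
  move=> uX vX uv nuv; apply/eqP; rewrite eqEcard deg2 // cardsDS; last first.
    by apply/subsetP=> z; rewrite !inE => /orP[]/eqP->.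
  rewrite X4 cards2 uv andbT; apply/subsetP=> z; rewrite !inE => /andP[-> uz].
  rewrite andbT; apply/negP=> /orP[]/eqP zE; first by rewrite zE adj_irr in uz.
  by rewrite -zE uz in nuv.
have [u uX] : exists u, u \in X by apply/card_gt0P; rewrite X4.
have KX : ncomp_in X = 1.
  apply/eqP; rewrite eqn_leq (ncomp_in_gt0 uX) andbT.
  apply: (ncomp_in_le1 (x := u)) => y yX.
  have [->|yu] := eqVneq y u; first exact: connect0.
  have [yu'|nyu] := boolP (adj y u); first exact: conn_adj.
  (* Non-adjacent vertices have the same two neighbours, so [y] reaches [u] through one of them. *)
  have /card_gt0P[z zy] : 0 < #|nbh X y| by rewrite deg2.
  have : z \in nbh X u.
    rewrite (nonadj u y) // ?[u == y]eq_sym //; last by rewrite adj_sym.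
    by rewrite setUC -(nonadj y u).
  move: zy; rewrite !inE => /andP[zX yz] /andP[_ uz].
  by apply: conn_trans (conn_adj yX zX yz) _; apply: conn_adj => //; rewrite adj_sym.
have -> : square_pairs X = \sum_(a in X) 1.
  rewrite /square_pairs [RHS]big_mkcond; apply: eq_bigr => a _.
  case: ifP => aX; last first.
    by rewrite big1 // => b _; rewrite subUset sub1set aX.
  rewrite (eq_bigr (fun b => (b \in X) && ~~ adj a b : nat)); last first.
    move=> b ab; congr nat_of_bool; rewrite subUset !sub1set aX /=.
    case: (boolP (b \in X)) => //= bX.
    apply/idP/idP=> [sub|nab]; last first.
      have Ea := nonadj _ _ aX bX ab nab.
      have Eb := nonadj b a bX aX; rewrite eq_sym ab adj_sym nab in Eb.
      apply/subsetP=> z zX; rewrite inE.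
      have : z \in nbh X a by rewrite Ea.
      have : z \in nbh X b by rewrite Eb // setUC.
      by rewrite !inE => /andP[_ ->] /andP[_ ->].
    apply/negP=> adjab.
    have /card_gt0P[z zX] : 0 < #|X :\: [set a; b]|.
      rewrite cardsDS ?X4 ?cards2 ?ab //.
      by apply/subsetP=> z; rewrite !inE => /orP[]/eqP->.
    by have := subsetP sub z zX; rewrite inE => /andP[az bz]; rewrite (tfG adjab bz) in az.
  (* Besides [a] and its two neighbours, [X] has exactly one vertex, the one opposite to [a]. *)
  have E : X = a |: ([set b in X | (a != b) && ~~ adj a b] :|: nbh X a).
    apply/setP=> b; rewrite !inE [b == a]eq_sym; case: eqP => [<-|_] /=; first by rewrite aX.
    by case: (b \in X); case: adj.
  have : #|X| = 1 + (#|[set b in X | (a != b) && ~~ adj a b]| + #|nbh X a|).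
    rewrite [in LHS]E cardsU1 !inE eqxx adj_irr !andbF /=; congr (_ + _).
    rewrite cardsU (_ : _ :&: _ = set0) ?cards0 ?subn0 //.
    by apply/setP=> b; rewrite !inE; case: (adj a b); rewrite ?andbF.
  rewrite deg2 // X4 -sum1_card => /eqP.
  have -> : \sum_(b in [set b in X | (a != b) && ~~ adj a b]) 1 =
     \sum_(b | a != b) ((b \in X) && ~~ adj a b).
    rewrite big_mkcond [RHS]big_mkcond; apply: eq_bigr => b _; rewrite inE.
    by case: (b \in X); case: (a != b); case: adj.
  by lia.
by rewrite KX dX sum1_card X4.
Qed.

End SmallSets.

(** * Graphs with the polynomial of the cube *)

Section SamePolynomial.

Variables G H : sgraph.
Hypothesis PE : subgraph_component_poly H = subgraph_component_poly G.

Lemma same_poly_card : #|H| = #|G|.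
Proof.
have := subgraph_component_poly_sum (fun i _ => i == 1 : nat) PE.
have E (K : sgraph) : \sum_(X : {set K}) (#|X| == 1 : nat) = #|K|.
  by rewrite -big_mkcond sum1dep_card card_draws bin1.
by rewrite !E.
Qed.

Lemma same_poly_sum_ncomp k :
  \sum_(X : {set H} | #|X| == k) ncomp_in X = \sum_(X : {set G} | #|X| == k) ncomp_in X.
Proof.
rewrite big_mkcond [RHS]big_mkcond.
exact: (subgraph_component_poly_sum (fun i j => if i == k then j else 0) PE).
Qed.

Lemma same_poly_sum_const k c :
  \sum_(X : {set H} | #|X| == k) c = \sum_(X : {set G} | #|X| == k) c.
Proof. by rewrite !sum_nat_cond_const !card_draws same_poly_card. Qed.

(** Euler's formula is exact on pairs, so the component counts at size 2 determine the number of
    edges. *)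
Lemma same_poly_degsum : degsum [set: H] = degsum [set: G].
Proof.
have := sum_degsum H 0; have := sum_degsum G 0; rewrite !bin0 !muln1 => <- <-.
have E (K : sgraph) : 2 * \sum_(X : {set K} | #|X| == 2) ncomp_in X +
    \sum_(X : {set K} | #|X| == 2) degsum X = \sum_(X : {set K} | #|X| == 2) 4.
  rewrite big_distrr -big_split; apply: eq_bigr => X /eqP; exact: euler_pair.
have := E H; have := E G; rewrite same_poly_sum_ncomp same_poly_sum_const.
by move=> <- /addnI.
Qed.

Lemma same_poly_sum_degsum k :
  \sum_(X : {set H} | #|X| == k.+2) degsum X = \sum_(X : {set G} | #|X| == k.+2) degsum X.
Proof. by rewrite !sum_degsum same_poly_degsum same_poly_card. Qed.

(** Summed over 3-sets, Euler's inequality is an equality in [G], hence also in [H]; so it is exact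
    on every 3-set of [H]. *)
Lemma same_poly_triangle_free : triangle_free G -> triangle_free H.
Proof.
move=> tfG u v w uv vw; apply/negP => uw.
have [X3 X6] := euler_triangle uv vw uw; move: X6; rewrite ltnNge => /negP; apply.
have sumE : \sum_(X : {set H} | #|X| == 3) 6 =
    \sum_(X : {set H} | #|X| == 3) (2 * ncomp_in X + degsum X).
  rewrite big_split /= -big_distrr /= same_poly_sum_ncomp same_poly_sum_degsum.
  rewrite big_distrr -big_split same_poly_sum_const /=.
  by apply: eq_bigr => X /eqP X3'; rewrite euler_triple.
have ge (X : {set H}) : #|X| == 3 -> 6 <= 2 * ncomp_in X + degsum X.
  by move=> /eqP X3'; have := euler_ge X; rewrite X3'.
by rewrite -(leq_sum_eq ge sumE) ?X3.
Qed.

(** The defect in Euler's formula at size 4 is [square_pairs], whose sum counts pairs of common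
    neighbours. *)
Lemma same_poly_common_nbh : triangle_free G ->
  \sum_(u : H) \sum_(v | u != v) 'C(#|common_nbh u v|, 2)
  = \sum_(u : G) \sum_(v | u != v) 'C(#|common_nbh u v|, 2).
Proof.
move=> tfG; have tfH := same_poly_triangle_free tfG.
rewrite -!sum_square_pairs.
have E (K : sgraph) : triangle_free K -> 4 * \sum_(X : {set K} | #|X| == 4) ncomp_in X +
    2 * \sum_(X : {set K} | #|X| == 4) degsum X =
    \sum_(X : {set K} | #|X| == 4) 16 + \sum_(X : {set K} | #|X| == 4) square_pairs X.
  move=> tfK; rewrite !big_distrr -!big_split; apply: eq_bigr => X /eqP; exact: euler_square.
have := E H tfH; have := E G tfG.
rewrite same_poly_sum_ncomp same_poly_sum_degsum same_poly_sum_const.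
by move=> -> /addnI.
Qed.

End SamePolynomial.

(** Of the [n * n] walks of length two from [u], exactly [n] return to [u]. *)
Lemma sum_common_nbh (G : sgraph) (n : nat) (u : G) :
  (forall v : G, #|nbh setT v| = n) ->
  \sum_(v | u != v) #|common_nbh u v| = n * n - n.
Proof.
move=> regG.
have -> : n * n = \sum_v #|common_nbh u v|.
  transitivity (\sum_(w in nbh setT u) n); first by rewrite sum_nat_const regG.
  transitivity (\sum_(w in nbh setT u) \sum_(v in nbh setT w) 1).
    by apply: eq_bigr => w _; rewrite sum1_card regG.
  under [RHS]eq_bigr do rewrite -sum1_card.
  rewrite (exchange_big_dep predT) //=; apply: eq_bigr => v _.
  by apply: eq_bigl => w; rewrite !inE /= [adj v w]adj_sym.
rewrite [in RHS](bigD1 u) //= (_ : common_nbh u u = nbh setT u); last first.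
  by apply/setP=> w; rewrite !inE andbb.
by rewrite regG addKn; apply: eq_bigl => v; rewrite eq_sym.
Qed.

(** * Local structure of a graph with the polynomial of the cube *)

Section CubePolynomial.

Variables (n : nat) (H : sgraph).
Hypothesis n2 : 2 <= n.
Hypothesis PE : subgraph_component_poly H = subgraph_component_poly (cube n).

Lemma cospec_card : #|H| = 2 ^ n.
Proof. by rewrite (same_poly_card PE) card_cube. Qed.

Lemma cospec_cardC (X : {set H}) : #|~: X| = 2 ^ n - #|X|.
Proof. by rewrite cardsCs setCK cospec_card. Qed.

Lemma cospec_ncomp_le1 (X : {set H}) : #|~: X| <= n.-1 -> ncomp_in X <= 1.
Proof.
(* The polynomial sees only [#|X|], so the number of deleted vertices is written [2 ^ n - i]. *)
have := subgraph_component_poly_all (P := fun i j => (2 ^ n - i <= n.-1) ==> (j <= 1)) PE.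
move=> h Xn; apply: (implyP (h _ X)); last by rewrite -cospec_cardC.
move=> Y; apply/implyP; rewrite -card_cube => Yn; apply: cube_ncomp_le1.
by rewrite cardsCs setCK.
Qed.

Lemma cospec_ncomp_le2 (X : {set H}) : #|~: X| + 3 <= 2 * n -> ncomp_in X <= 2.
Proof.
have := subgraph_component_poly_all
  (P := fun i j => (2 ^ n - i + 3 <= 2 * n) ==> (j <= 2)) PE.
move=> h Xn; apply: (implyP (h _ X)); last by rewrite -cospec_cardC.
move=> Y; apply/implyP; rewrite -card_cube => Yn; apply: cube_ncomp_le2.
by rewrite cardsCs setCK.
Qed.

Lemma cospec_connected (u v : H) : conn setT u v.
Proof.
apply: conn_of_ncomp_in_le1 => //.
by apply: cospec_ncomp_le1; rewrite setCT cards0.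
Qed.

Lemma cospec_triangle_free : triangle_free H.
Proof. exact: same_poly_triangle_free PE (@cube_triangle_free n). Qed.

(** Deleting the neighbours of [v] isolates it from a further vertex [w], whereas fewer than [n]
    deletions leave [H] connected. *)
Lemma cospec_min_degree (v : H) : n <= #|nbh setT v|.
Proof.
rewrite leqNgt; apply/negP => dv.
have X1 : ncomp_in (~: nbh setT v) <= 1.
  by apply: cospec_ncomp_le1; rewrite setCK; lia.
have [w] : exists w, w \in ~: (v |: nbh setT v).
  apply/card_gt0P; rewrite cardsCs setCK cospec_card subn_gt0.
  apply: leq_ltn_trans (_ : n < _); last exact: ltn_expl.
  by rewrite cardsU1; case: (_ \notin _) => //=; lia.
rewrite in_setC in_setU1 negb_or => /andP[wv wN].
have vX : v \in ~: nbh setT v by rewrite !inE adj_irr.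
have wX : w \in ~: nbh setT v by rewrite inE.
have := conn_of_ncomp_in_le1 X1 vX wX.
move/(conn_label (f := fun x => x == v)); rewrite eqxx (negbTE wv).
suff : forall x y, x \in ~: nbh setT v -> y \in ~: nbh setT v -> adj x y -> (x == v) = (y == v).
  by move=> h /(_ h).
move=> x y; rewrite !inE => vx vy xy; case: eqP => [xv|_]; first by rewrite -xv xy in vy.
by case: eqP => // yv; rewrite -yv adj_sym xy in vx.
Qed.

Lemma cospec_regular (v : H) : #|nbh setT v| = n.
Proof.
have := same_poly_degsum PE; rewrite /degsum.
rewrite [RHS](eq_bigr (fun=> n)); last by move=> u _; apply: cube_regular.
rewrite sum_nat_const cardsT card_cube -cospec_card -cardsT -sum_nat_const => /esym E.
by have := leq_sum_eq (fun u _ => cospec_min_degree u) E; move/(_ v (in_setT v)) => <-.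
Qed.

(** With three common neighbours, at most [2 * n - 3] deletions isolate both [u] and [v]; a further
    vertex [w] remains, which makes three components. *)
Lemma cospec_common_nbh_le2 (u v : H) : u != v -> #|common_nbh u v| <= 2.
Proof.
move=> uv; rewrite leqNgt; apply/negP => c3.
have nuv : ~~ adj u v.
  apply/negP => adjuv; have /card_gt0P[w] : 0 < #|common_nbh u v| by lia.
  by rewrite inE => /andP[uw vw]; rewrite (cospec_triangle_free adjuv vw) in uw.
pose F := nbh setT u :|: nbh setT v.
have cF : #|F| + 3 <= 2 * n.
  rewrite /F cardsU !cospec_regular (_ : _ :&: _ = common_nbh u v); first by lia.
  by apply/setP=> w; rewrite !inE.
have X2 : ncomp_in (~: F) <= 2 by apply: cospec_ncomp_le2; rewrite setCK.
have [w] : exists w, w \in ~: ([set u; v] :|: F).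
  apply/card_gt0P; rewrite cardsCs setCK cospec_card subn_gt0.
  apply: leq_ltn_trans (leq_card_setU _ _) _; rewrite cards2 uv.
  suff : 2 * n <= 2 ^ n by lia.
  by case: (n) => // m; rewrite expnS leq_mul2l ltn_expl.
rewrite in_setC in_setU in_set2 !negb_or => /andP[/andP[wu wv] wF].
(* Three labels, for [u], for [v] and for everything else. *)
pose f (x : H) : 'I_3 := if x == u then 0%R else if x == v then 1%R else 2%R.
have fE x y : x \in ~: F -> y \in ~: F -> adj x y -> f x = f y.
  have nF z t : z \in ~: F -> adj t z -> (t == u = false) * (t == v = false).
    rewrite !inE !negb_or => /andP[uz vz] tz.
    by split; [apply: contraNF uz|apply: contraNF vz] => /eqP<-.
  move=> xF yF xy; have yx : adj y x by rewrite adj_sym.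
  by rewrite /f !(nF y x) // !(nF x y).
have := leq_trans (ncomp_in_ge fE) X2; rewrite leqNgt => /negP; apply.
suff /subset_leq_card : setT \subset f @: (~: F) by rewrite cardsT card_ord.
apply/subsetP=> i _.
have uF : u \in ~: F by rewrite !inE adj_irr /= adj_sym.
have vF : v \in ~: F by rewrite !inE adj_irr (negbTE nuv).
have wF' : w \in ~: F by rewrite inE.
have fu : f u = 0%R by rewrite /f eqxx.
have fv : f v = 1%R by rewrite /f eqxx eq_sym (negbTE uv).
have fw : f w = 2%R by rewrite /f (negbTE wu) (negbTE wv).
have : (i == f u) || (i == f v) || (i == f w) by rewrite fu fv fw; case: i => [[|[|[|]]]].
by rewrite -orbA => /or3P[]/eqP->; apply: imset_f.
Qed.

(** For c at most 2, [2 * 'C(c, 2) <= c] is strict only at c = 1. Summed over all pairs it is an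
    equality, as both sums agree with those of the cube. *)
Lemma cospec_common_nbh (u v : H) : u != v ->
  #|common_nbh u v| = 0 \/ #|common_nbh u v| = 2.
Proof.
move=> uv; have c2 := cospec_common_nbh_le2 uv.
suff : 2 * 'C(#|common_nbh u v|, 2) = #|common_nbh u v|.
  by case: #|_| c2 => [|[|[|]]] //; [left|right].
have le (x y : H) : x != y -> 2 * 'C(#|common_nbh x y|, 2) <= #|common_nbh x y|.
  by move=> xy; have := cospec_common_nbh_le2 xy; case: #|_| => [|[|[|]]].
have leS (x : H) : true -> \sum_(y | x != y) 2 * 'C(#|common_nbh x y|, 2)
    <= \sum_(y | x != y) #|common_nbh x y|.
  by move=> _; apply: leq_sum => y; apply: le.
have sumE : \sum_(x : H) \sum_(y | x != y) 2 * 'C(#|common_nbh x y|, 2)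
    = \sum_(x : H) \sum_(y | x != y) #|common_nbh x y|.
  transitivity (2 * \sum_(x : H) \sum_(y | x != y) 'C(#|common_nbh x y|, 2)).
    by rewrite [RHS]big_distrr; apply: eq_bigr => x _; rewrite [RHS]big_distrr.
  have sc (K : sgraph) : (forall x : K, #|nbh setT x| = n) ->
      \sum_(x : K) \sum_(y | x != y) #|common_nbh x y| = #|K| * (n * n - n).
    move=> regK; rewrite -sum_nat_const; apply: eq_bigr => x _.
    exact: sum_common_nbh.
  rewrite (same_poly_common_nbh PE (@cube_triangle_free n)).
  rewrite sc; last exact: cospec_regular.
  rewrite (same_poly_card PE) -(sc _ (@cube_regular n)) big_distrr /=.
  apply: eq_bigr => x _; rewrite big_distrr /=; apply: eq_bigr => y xy.
  by case: (cube_common_nbh xy) => ->.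
have := leq_sum_eq leS sumE (i := u) isT.
by move/(leq_sum_eq (le u))/(_ v uv).
Qed.

End CubePolynomial.

(** * Regular graphs with zero or two common neighbours *)

(** Walks of length exactly [m], as a Boolean so that [ex_minn] can yield the distance. *)
Fixpoint walk (G : sgraph) (m : nat) (u v : G) : bool :=
  if m is m'.+1 then [exists w, adj u w && walk m' w v] else u == v.

Lemma walk_rcons (G : sgraph) m (u w v : G) : walk m u w -> adj w v -> walk m.+1 u v.
Proof.
elim: m u => [|m IH] u /=.
  by move=> /eqP-> wv; apply/existsP; exists v; rewrite wv eqxx.
case/existsP=> x /andP[ux xw] wv; apply/existsP; exists x; rewrite ux.
exact: IH.
Qed.

Lemma walk_sym (G : sgraph) m (u v : G) : walk m u v -> walk m v u.
Proof.
elim: m u => [|m IH] u /=; first by rewrite eq_sym.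
by case/existsP=> w /andP[uw wv]; apply: walk_rcons (IH _ wv) _; rewrite adj_sym.
Qed.

Lemma conn_walk (G : sgraph) (u v : G) : conn setT u v -> exists m, walk m u v.
Proof.
case/connectP=> p; elim: p u => [|w p IH] u /=; first by move=> _ ->; exists 0 => /=.
case/andP=> /and3P[_ _ uw] pw vE; have [m wv] := IH w pw vE.
by exists m.+1; apply/existsP; exists w; rewrite uw.
Qed.

Section Rectagraph.

Variables (G : sgraph) (n : nat).
Hypothesis connG : forall u v : G, conn setT u v.
Hypothesis regG : forall u : G, #|nbh setT u| = n.
Hypothesis commonG : forall u v : G, u != v ->
  #|common_nbh u v| = 0 \/ #|common_nbh u v| = 2.
Hypothesis cardG : #|G| = 2 ^ n.
Implicit Types (u v w x y z b : G).

Definition dist u v : nat := ex_minn (conn_walk (connG u v)).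

Lemma dist_le m u v : walk m u v -> dist u v <= m.
Proof. by rewrite /dist; case: ex_minnP => k _ h /h. Qed.

Lemma dist_walk u v : walk (dist u v) u v.
Proof. by rewrite /dist; case: ex_minnP. Qed.

Lemma dist_sym u v : dist u v = dist v u.
Proof.
by apply/eqP; rewrite eqn_leq; apply/andP; split; apply/dist_le/walk_sym/dist_walk.
Qed.

Lemma dist_eq0 u v : (dist u v == 0) = (u == v).
Proof.
apply/eqP/idP => [d0|uv]; first by have := dist_walk u v; rewrite d0.
by apply/eqP; rewrite -leqn0; apply: dist_le.
Qed.

Lemma distxx u : dist u u = 0.
Proof. by apply/eqP; rewrite dist_eq0. Qed.

Lemma dist_adj u v w : adj u w -> dist u v <= (dist w v).+1.
Proof.
by move=> uw; apply: dist_le; apply/existsP; exists w; rewrite uw; apply: dist_walk.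
Qed.

Definition down b x : {set G} := [set w | adj x w & dist x b == (dist w b).+1].

Lemma downP {b x w} : reflect (adj x w /\ dist x b = (dist w b).+1) (w \in down b x).
Proof. by rewrite inE; apply: (iffP andP) => -[xw /eqP]. Qed.

Lemma down_exists b x : 0 < dist x b -> exists w, w \in down b x.
Proof.
move=> dx; have := dist_walk x b; case E: (dist x b) dx => [//|m] _ /existsP[w /andP[xw wb]].
exists w; apply/downP; split=> //.
by have := dist_le wb; have := dist_adj b xw; lia.
Qed.

Lemma common_nbh_le2 u v : u != v -> #|common_nbh u v| <= 2.
Proof. by move=> /commonG[] ->. Qed.

Lemma three_common_nbh u v x y z : u != v ->
  x \in common_nbh u v -> y \in common_nbh u v -> z \in common_nbh u v ->
  x != y -> x != z -> y != z -> False.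
Proof.
move=> uv xC yC zC xy xz yz; have := common_nbh_le2 uv; rewrite leqNgt => /negP; apply.
by apply/card_gt2P; exists x, y, z; split; split=> //; rewrite eq_sym.
Qed.

(** Common neighbours come in pairs: the path [u], [w], [v] closes up to a 4-cycle. *)
Lemma other_common_nbh u v w : u != v -> w \in common_nbh u v ->
  exists2 z, z \in common_nbh u v & z != w.
Proof.
move=> uv wC; have [c0|c2] := commonG uv.
  by rewrite (card0_eq c0) in wC.
have /card_gt0P[z] : 0 < #|common_nbh u v :\ w|.
  by have := cardsD1 w (common_nbh u v); rewrite wC c2; lia.
by rewrite !inE => /andP[zw zC]; exists z; rewrite ?inE.
Qed.

(* A down-neighbour [w] of [x] together with the other common neighbours of [x]
   and the down-neighbours of [w]. *)
Lemma dist_le_card_down b x : dist x b <= #|down b x|.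
Proof.
move E : (dist x b) => m; elim: m x E => // m IH x dx.
have [|w wD] := @down_exists b x; first by rewrite dx.
have [xw dw] := downP wD; rewrite dx in dw; case: dw => dw.
(* The default [w] is never returned for [y] in [down b w]. *)
pose other y := odflt w [pick z in common_nbh x y :\ w].
have otherP y : y \in down b w ->
    [/\ adj x (other y), adj y (other y), other y != w & other y \in down b x].
  move=> /downP[wy dy].
  have xy : x != y by apply/eqP=> xy; move: dx; rewrite xy; lia.
  have wC : w \in common_nbh x y by rewrite inE xw adj_sym.
  have [z zC zw] := other_common_nbh xy wC.
  rewrite /other; case: pickP => [t|/(_ z)]; last by rewrite !inE zw in zC *; rewrite zC.
  rewrite !inE /= => /and3P[tw xt yt]; rewrite xt yt tw; split=> //.
  (* Adjacency to [x] and to [y] forces [t] to be at distance [m] from [b]. *)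
  have := dist_adj b xt; have ty : adj t y by rewrite adj_sym.
  by have := dist_adj b ty; lia.
(* A repeated value would share [x], [y] and [y'] as neighbours with [w]. *)
have oI : {in down b w &, injective other}.
  move=> y y' yD y'D E; apply/eqP; apply: contraT => yy'.
  have [xo yo ow _] := otherP y yD; have [_ yo' _ _] := otherP y' y'D.
  have [wy dy] := downP yD; have [wy' dy'] := downP y'D.
  have wo : w != other y by rewrite eq_sym.
  have ne t : t \in down b w -> x != t.
    by move=> /downP[_ dt]; apply/eqP=> xt; move: dx; rewrite xt; lia.
  by case: (three_common_nbh (x := x) (y := y) (z := y') wo); rewrite ?inE ?ne //
    ?[adj w x]adj_sym ?[adj (other y) _]adj_sym ?xw ?xo ?wy ?yo ?wy' ?E ?yo'.
apply: leq_trans (_ : #|w |: other @: down b w| <= _).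
  rewrite cardsU1 card_in_imset // (_ : w \notin _) ?ltnS ?IH //.
  by apply/imsetP=> -[y /otherP[_ _ yw _] wE]; rewrite -wE eqxx in yw.
apply/subset_leq_card/subsetP=> z /setU1P[->//|/imsetP[y /otherP[_ _ _ ?] ->//]].
Qed.

Definition sphere b i : {set G} := [set x | dist x b == i].

Definition up b x : {set G} := [set w | adj x w & dist w b == (dist x b).+1].

(** Both sides count the edges between consecutive spheres. *)
Lemma sum_card_down b i :
  \sum_(x in sphere b i.+1) #|down b x| = \sum_(x in sphere b i) #|up b x|.
Proof.
under eq_bigr do rewrite -sum1_card; under [RHS]eq_bigr do rewrite -sum1_card.
rewrite (exchange_big_dep (mem (sphere b i))) /=; last first.
  by move=> x w; rewrite !inE => /eqP-> /andP[_]; rewrite eqSS eq_sym.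
apply: eq_bigr => w; rewrite inE => /eqP dw; apply: eq_bigl => x.
rewrite !inE dw adj_sym; case: (adj w x); rewrite ?andbF //=.
by rewrite andbb.
Qed.

Lemma card_up_le b x : #|up b x| <= n - dist x b.
Proof.
have : #|up b x| + #|down b x| <= n.
  rewrite -(regG x); apply: leq_trans (_ : #|up b x :|: down b x| <= _).
    rewrite cardsU (_ : _ :&: _ = set0) ?cards0 ?subn0 //.
    apply/setP=> w; rewrite !inE; apply/negP=> /andP[/andP[_ /eqP->] /andP[_ /eqP]]; lia.
  by apply/subset_leq_card/subsetP=> w; rewrite !inE => /orP[]/andP[->].
by have := dist_le_card_down b x; lia.
Qed.

Lemma sum_card_down_le b i :
  \sum_(x in sphere b i.+1) #|down b x| <= (n - i) * #|sphere b i|.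
Proof.
rewrite sum_card_down mulnC -sum_nat_const; apply: leq_sum => x.
by rewrite inE => /eqP <-; apply: card_up_le.
Qed.

Lemma sum_card_down_ge b i :
  i * #|sphere b i| <= \sum_(x in sphere b i) #|down b x|.
Proof.
rewrite mulnC -sum_nat_const; apply: leq_sum => x.
by rewrite inE => /eqP <-; apply: dist_le_card_down.
Qed.

(** The two bounds on the edges between spheres give the recurrence of the binomials as an
    inequality. *)
Lemma card_sphere_le b i : #|sphere b i| <= 'C(n, i).
Proof.
elim: i => [|i IH].
  rewrite bin0 -(cards1 b); apply/subset_leq_card/subsetP=> x.
  by rewrite !inE dist_eq0.
rewrite -(leq_pmul2l (ltn0Sn i)) mul_bin_left.
apply: leq_trans (sum_card_down_ge b i.+1) _; apply: leq_trans (sum_card_down_le b i) _.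
by rewrite leq_mul2l IH orbT.
Qed.

(** Spheres partition the [2 ^ n] vertices and the binomials also sum to [2 ^ n], so no bound is
    strict. *)
Lemma card_sphere b i : #|sphere b i| = 'C(n, i).
Proof.
have [ni|ni] := ltnP n i.
  by apply/eqP; rewrite eqn_leq card_sphere_le bin_small.
have dn x : dist x b < n.+1.
  rewrite ltnS leqNgt; apply/negP=> nd; have := card_sphere_le b (dist x b).
  by rewrite bin_small // leqn0 => /eqP/card0_eq/(_ x); rewrite inE eqxx.
have sumE : \sum_(j < n.+1) #|sphere b j| = \sum_(j < n.+1) 'C(n, j).
  transitivity #|G|.
    rewrite -sum1_card (partition_big (fun x => Ordinal (dn x)) predT) //=.
    by apply: eq_bigr => j _; rewrite -sum1_card; apply: eq_bigl => x; rewrite inE.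
  rewrite cardG -[2]/(1 + 1) expnDn; apply: eq_bigr => j _.
  by rewrite !exp1n !muln1.
have le (j : 'I_n.+1) : true -> #|sphere b j| <= 'C(n, j) by move=> _; apply: card_sphere_le.
have i1 : i < n.+1 by [].
exact: leq_sum_eq le sumE (Ordinal i1) isT.
Qed.

(** Over the sphere of radius [i.+1], the upper bound [(n - i) * 'C(n, i)] equals the lower bound
    [i.+1 * 'C(n, i.+1)], so every term is minimal. *)
Lemma card_down b x : #|down b x| = dist x b.
Proof.
case E: (dist x b) => [|i].
  by apply/eqP; rewrite cards_eq0; apply/eqP/setP=> w; rewrite !inE E andbF.
have le y : y \in sphere b i.+1 -> i.+1 <= #|down b y|.
  by rewrite inE => /eqP <-; apply: dist_le_card_down.
have sumE : \sum_(y in sphere b i.+1) i.+1 = \sum_(y in sphere b i.+1) #|down b y|.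
  apply/eqP; rewrite eqn_leq leq_sum //= sum_nat_const card_sphere.
  by rewrite mulnC mul_bin_left -(card_sphere b) sum_card_down_le.
by apply/esym/(leq_sum_eq le sumE); rewrite inE E.
Qed.

(** * Coordinates relative to a base point *)

Section Coordinates.

Variable u : G.

(** The arguments of [down] are swapped: these are the neighbours of the base point that are closer
    to [v], and stand for the coordinates equal to 1. *)
Definition coords v : {set G} := down v u.

Lemma card_coords v : #|coords v| = dist u v.
Proof. exact: card_down. Qed.

(** By the triangle inequality through [w], a step from [u] that approaches [w] also approaches
    [v]. *)
Lemma coords_down v w : w \in down u v -> coords w \subset coords v.
Proof.
move=> /downP[vw dv]; apply/subsetP=> a /downP[ua da]; apply/downP; split=> //.
have := dist_adj u ua; have := dist_adj v ua; have := dist_adj a vw.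
rewrite (dist_sym v a) (dist_sym w a); move: dv; rewrite (dist_sym v u) (dist_sym w u).
by lia.
Qed.

Definition lower_coords v : {set {set G}} :=
  [set A : {set G} | A \subset coords v & #|A| == (dist u v).-1].

Lemma coords_down_lower v : coords @: down u v \subset lower_coords v.
Proof.
apply/subsetP=> _ /imsetP[w wD ->]; rewrite inE coords_down // card_coords.
by have [_] := downP wD; rewrite (dist_sym v u) (dist_sym w u) => ->; rewrite eqxx.
Qed.

(** Both sides have [dist u v] elements once [coords] is injective. *)
Lemma coords_down_eq v : 0 < dist u v -> {in down u v &, injective coords} ->
  coords @: down u v = lower_coords v.
Proof.
move=> dv inj; apply/eqP; rewrite eqEcard coords_down_lower card_in_imset //.
rewrite cards_draws card_coords card_down (dist_sym v u).
by case: (dist u v) dv => // m _; rewrite /= binSn.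
Qed.

(* Two vertices at distance k >= 2 with equal coordinates share all their k
   down-neighbours, hence k = 2; then these two share the base point as well. *)
Lemma coords_inj : injective coords.
Proof.
move=> v1 v2; move E: (dist u v1) => k.
elim: k v1 v2 E => [|k IH] v1 v2 d1 E.
  have d2 : dist u v2 = 0 by rewrite -card_coords -E card_coords.
  by move/eqP: d1; move/eqP: d2; rewrite !dist_eq0 => /eqP<- /eqP<-.
have d2 : dist u v2 = k.+1 by rewrite -card_coords -E card_coords.
have dD v w : dist u v = k.+1 -> w \in down u v -> dist u w = k.
  by move=> dv /downP[_]; rewrite (dist_sym v u) (dist_sym w u) dv => -[].
have inj v : dist u v = k.+1 -> {in down u v &, injective coords}.
  by move=> dv x y xD yD; apply: IH; apply: dD xD.
apply/eqP; apply: contraT => v12.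
(* The coordinate sets of down-neighbours depend only on [coords v1]; the induction hypothesis
   recovers the vertices. *)
have D12 : down u v1 \subset down u v2.
  apply/subsetP=> x xD.
  have : coords x \in coords @: down u v2.
    rewrite coords_down_eq ?d2 //; last exact: inj.
    rewrite /lower_coords -E d2 -d1 -/(lower_coords v1) -coords_down_eq ?d1 //; last exact: inj.
    exact: imset_f.
  by case/imsetP=> y yD /(IH _ _ (dD _ _ d1 xD)) ->.
have DC : down u v1 \subset common_nbh v1 v2.
  apply/subsetP=> x xD; rewrite inE.
  by have [-> _] := downP xD; have [-> _] := downP (subsetP D12 _ xD).
have := leq_trans (subset_leq_card DC) (common_nbh_le2 v12).
rewrite card_down dist_sym d1 ltnS => k1.
have [k0|k0] := posnP k.
  subst k.
  (* At distance 1, [v1] lies in its own coordinates, hence in those of [v2], so it is at distance 0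
     from [v2]. *)
  have v1c : v1 \in coords v1.
    apply/downP; rewrite d1 distxx; split=> //.
    have := dist_walk u v1; rewrite d1 /= => /existsP[w /andP[uw /eqP <-]] //.
  rewrite E in v1c; have [_] := downP v1c; rewrite d2 => -[/esym/eqP].
  by rewrite dist_eq0 (negbTE v12).
have {k0}kE : k = 1 by lia.
subst k.
have /cards2P[x [y [xy DE]]] : #|down u v1| == 2 by rewrite card_down dist_sym d1.
have xD : x \in down u v1 by rewrite DE set21.
have yD : y \in down u v1 by rewrite DE set22.
have ux z : z \in down u v1 -> adj z u.
  move=> zD; have := dist_walk u z; rewrite (dD _ _ d1 zD) /=.
  by case/existsP=> w /andP[uw /eqP <-]; rewrite adj_sym.
have zv z : z \in down u v1 -> adj z v1 && adj z v2.
  by move=> /(subsetP DC); rewrite inE ![adj z _]adj_sym.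
have nu v : dist u v = 2 -> u != v by rewrite -dist_eq0 => ->.
have [xv1 xv2] := andP (zv x xD); have [yv1 yv2] := andP (zv y yD).
by case: (three_common_nbh (x := u) (y := v1) (z := v2) xy); rewrite ?inE ?nu ?ux ?xv1 ?xv2 ?yv1 ?yv2.
Qed.

(** The smaller set belongs to some down-neighbour of [v], which is [w] by injectivity. *)
Lemma adj_of_coordsD1 v w a : a \in coords v -> coords w = coords v :\ a -> adj v w.
Proof.
move=> av wE; have : coords w \in lower_coords v.
  by rewrite inE wE subD1set -card_coords (cardsD1 a (coords v)) av eqxx.
have dv : 0 < dist u v by rewrite -card_coords (cardsD1 a (coords v)) av.
rewrite -coords_down_eq //; last by move=> ? ? _ _; apply: coords_inj.
by case/imsetP=> x xD /coords_inj->; have [] := downP xD.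
Qed.

(** [phi] gives characteristic vectors of coordinate sets. It is injective, hence bijective by
    cardinality, and reflects adjacency. *)
Lemma rectagraph_cube : isomorphic G (cube n).
Proof.
pose e (i : 'I_n) := enum_val (cast_ord (esym (regG u)) i).
have eP a : adj u a -> exists i, a = e i.
  move=> ua; have aN : a \in nbh setT u by rewrite !inE.
  exists (cast_ord (regG u) (enum_rank_in aN a)).
  by rewrite /e cast_ordK enum_rankK_in.
have eI : injective e by move=> i j /enum_val_inj/cast_ord_inj.
pose phi v : cube n := [ffun i => e i \in coords v].
have phiI : injective phi.
  move=> v w /ffunP vw; apply: coords_inj; apply/setP=> a.
  have [/eP[i ->]|na] := boolP (adj u a); first by have := vw i; rewrite !ffunE.
  by rewrite !inE (negbTE na).
have phiB : bijective phi by apply: inj_card_bij; rewrite // card_cube cardG.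
have phi_down v w i : phi w = flip i (phi v) -> e i \in coords v -> adj v w.
  move=> /ffunP wv iv; apply: (adj_of_coordsD1 iv); apply/setP=> a; rewrite in_setD1.
  have [/eP[j ->]|na] := boolP (adj u a); last by rewrite !inE (negbTE na) andbF.
  have := wv j; rewrite flipE !ffunE (inj_eq eI).
  by have [->|] := eqVneq j i; rewrite ?iv.
have phi_adj v w : adj (phi v) (phi w) -> adj v w.
  (* The coordinate [i] is set in exactly one of [v] and [w]; the argument starts from that one. *)
  case/cube_adjP=> i wv; have [iv|iv] := boolP (e i \in coords v); first exact: phi_down wv iv.
  rewrite adj_sym; apply: (phi_down _ _ i); first by rewrite wv flipK.
  by have /ffunP/(_ i) := wv; rewrite flipE !ffunE eqxx (negbTE iv) => ->.
exists phi => // v w.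
(* An inclusion between sets of [n] elements: regularity makes [phi] preserve adjacency too. *)
have : phi @^-1: nbh setT (phi v) = nbh setT v.
  apply/eqP; rewrite eqEcard on_card_preimset ?cube_regular ?regG ?leqnn ?andbT.
    by apply/subsetP=> x; rewrite !inE; apply: phi_adj.
  exact: onW_bij.
by move/setP/(_ w); rewrite !inE.
Qed.

End Coordinates.

End Rectagraph.

Theorem theorem4p12 (n : nat) (hn : 2 <= n) : Q_unique (cube n).
Proof.
move=> H PE.
have [u _] : exists u : H, u \in predT by apply/card_gt0P; rewrite (cospec_card PE) expn_gt0.
exact: (rectagraph_cube (cospec_connected PE) (cospec_regular hn PE)
  (cospec_common_nbh hn PE) (cospec_card PE) u).
Qed.
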